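(* Let $r,n\geq1$ be integers, let $\operatorname{O}(r)$ act on $\mathbb R^{r\times n}$ by left matrix multiplication, and define $\phi\colon\mathbb R^{r\times n}\to\mathbb R^{n\times n}$ by $\phi(X)=\sqrt{X^TX}$ (positive semidefinite square root). Then for all $X,Y\in\mathbb R^{r\times n}$, $$d_{\operatorname{O}(r)}([X],[Y])\leq\|\phi(X)-\phi(Y)\|_F\leq\sqrt2\cdot d_{\operatorname{O}(r)}([X],[Y]).$$ The lower Lipschitz bound ($1$) is tight for all $n\geq1$, and the upper Lipschitz bound ($\sqrt2$) is tight for all $n\geq2$. Moreover, for all $n\geq2$, $$c_2\big(\mathbb R^{r\times n}/\operatorname{O}(r)\big)=\kappa(\phi_{/\operatorname{O}(r)})=\sqrt2.$$
   Context: $\mathbb R^{r\times n}$ carries the Frobenius inner product $\langle X,Y\rangle=\operatorname{Tr}(X^TY)$, $\|\cdot\|_F$ is the Frobenius norm, and $d_{\operatorname{O}(r)}([X],[Y])=\min_{Q\in\operatorname{O}(r)}\|QX-Y\|_F$ is the quotient metric on $\mathbb R^{r\times n}/\operatorname{O}(r)$. Since $\phi$ is $\operatorname{O}(r)$-invariant, it induces $\phi_{/\operatorname{O}(r)}\colon\mathbb R^{r\times n}/\operatorname{O}(r)\to\mathbb R^{n\times n}$, $[X]\mapsto\phi(X)$. A Lipschitz bound is tight if it is the optimal such constant. For a map $f\colon X\to Y$ of metric spaces, the optimal lower and upper Lipschitz bounds $\alpha,\beta\in[0,\infty]$ are the largest and smallest constants (respectively) with $\alpha\, d_X(x,x')\le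 d_Y(f(x),f(x'))\le\beta\, d_X(x,x')$ for all $x,x'\in X$; the distortion of $f$ is $\kappa(f):=\beta/\alpha$, with $\kappa(f)=\infty$ if $\alpha=0$ or $\beta=\infty$. The Euclidean distortion $c_2(X)\in[1,\infty]$ is the infimum of all $c$ for which there exist a Hilbert space $H$ and a map $f\colon X\to H$ with $\kappa(f)=c$. *)

(* Defs.v *)
From HB Require Import structures.
From mathcomp Require Import all_boot all_order all_algebra generic_quotient ring lra.
From mathcomp Require Import all_classical all_reals all_analysis.

Set Implicit Arguments.
Unset Strict Implicit.
Unset Printing Implicit Defensive.

Import Order.TTheory GRing.Theory Num.Theory.
Import numFieldNormedType.Exports.

Local Open Scope classical_set_scope.
Local Open Scope ring_scope.
Local Open Scope quotient_scope.

Section Frobenius.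
Context {R : realType}.

Definition frob_inner {m n} (X Y : 'M[R]_(m, n)) : R := \tr (X^T *m Y).

Definition frob_norm {m n} (X : 'M[R]_(m, n)) : R := Num.sqrt (frob_inner X X).

Lemma frob_innerE m n (X Y : 'M[R]_(m, n)) :
  frob_inner X Y = \sum_j \sum_i X i j * Y i j.
Proof.
apply: eq_bigr => j _; rewrite mxE; apply: eq_bigr => i _.
by rewrite mxE.
Qed.

Lemma frob_inner_sym m n (X Y : 'M[R]_(m, n)) :
  frob_inner X Y = frob_inner Y X.
Proof. by rewrite /frob_inner -mxtrace_tr trmx_mul trmxK. Qed.

Lemma frob_inner_linear m n a (X Y Z : 'M[R]_(m, n)) :
  frob_inner (a *: X + Y) Z = a * frob_inner X Z + frob_inner Y Z.
Proof.
by rewrite /frob_inner linearP /= mulmxDl mxtraceD -scalemxAl mxtraceZ.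
Qed.

Lemma frob_inner_ge0 m n (X : 'M[R]_(m, n)) : 0 <= frob_inner X X.
Proof.
by rewrite frob_innerE; do 2!apply: sumr_ge0 => ? _; rewrite -expr2 sqr_ge0.
Qed.

Lemma frob_inner_eq0 m n (X : 'M[R]_(m, n)) : frob_inner X X = 0 -> X = 0.
Proof.
rewrite frob_innerE => /eqP; rewrite psumr_eq0; last first.
  by move=> j _; apply: sumr_ge0 => i _; rewrite -expr2 sqr_ge0.
move=> /allP h; apply/matrixP => i j; rewrite mxE.
have := h j (mem_index_enum _); rewrite /= psumr_eq0; last first.
  by move=> k _; rewrite -expr2 sqr_ge0.
move=> /allP /(_ i (mem_index_enum _)) /=.
by rewrite mulf_eq0 orbb => /eqP.
Qed.

Lemma frob_norm_ge0 m n (X : 'M[R]_(m, n)) : 0 <= frob_norm X.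
Proof. exact: sqrtr_ge0. Qed.

Lemma sqr_frob_norm m n (X : 'M[R]_(m, n)) :
  frob_norm X ^+ 2 = frob_inner X X.
Proof. by rewrite sqr_sqrtr// frob_inner_ge0. Qed.

Lemma frob_norm_eq0 m n (X : 'M[R]_(m, n)) : frob_norm X = 0 -> X = 0.
Proof.
by move=> X0; apply: frob_inner_eq0; rewrite -sqr_frob_norm X0 expr0n.
Qed.

Lemma frob_norm0 m n : frob_norm (0 : 'M[R]_(m, n)) = 0.
Proof. by rewrite /frob_norm /frob_inner mulmx0 mxtrace0 sqrtr0. Qed.

Lemma frob_normN m n (X : 'M[R]_(m, n)) : frob_norm (- X) = frob_norm X.
Proof. by rewrite /frob_norm /frob_inner [(- X)^T]raddfN mulNmx mulmxN opprK. Qed.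

Lemma frob_inner_combo m n (a b : R) (X Y : 'M[R]_(m, n)) :
  frob_inner (a *: X + b *: Y) (a *: X + b *: Y) =
  a ^+ 2 * frob_inner X X + 2 * (a * b) * frob_inner X Y
  + b ^+ 2 * frob_inner Y Y.
Proof.
have addl U V W : frob_inner (U + V) W = frob_inner U W + frob_inner V W.
  by rewrite -[U in U + V]scale1r frob_inner_linear mul1r.
have scalel c (U V : 'M[R]_(m, n)) :
    frob_inner (c *: U) V = c * frob_inner U V.
  by rewrite /frob_inner linearZ /= -scalemxAl mxtraceZ.
rewrite !addl !scalel ![frob_inner _ (_ + _)]frob_inner_sym !addl !scalel.
rewrite [frob_inner Y X]frob_inner_sym; ring.
Qed.

Lemma frob_inner_le m n (X Y : 'M[R]_(m, n)) :
  frob_inner X Y <= frob_norm X * frob_norm Y.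
Proof.
have [XY0|XY0] := ltP (frob_inner X Y) 0.
  by apply/ltW/(lt_le_trans XY0); rewrite mulr_ge0 ?frob_norm_ge0.
rewrite -ler_sqr ?nnegrE ?mulr_ge0 ?frob_norm_ge0// exprMn !sqr_frob_norm.
have [Y0|Y_neq0] := eqVneq (frob_inner Y Y) 0.
  by rewrite (frob_inner_eq0 Y0) /frob_inner !mulmx0 mxtrace0 expr0n mulr0.
have Y_gt0 : 0 < frob_inner Y Y by rewrite lt_neqAle eq_sym Y_neq0 frob_inner_ge0.
rewrite -subr_ge0 -(pmulr_rge0 _ Y_gt0).
have := frob_inner_ge0 (frob_inner Y Y *: X + (- frob_inner X Y) *: Y).
rewrite frob_inner_combo; congr (0 <= _); ring.
Qed.

Lemma ler_frob_normD m n (X Y : 'M[R]_(m, n)) :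
  frob_norm (X + Y) <= frob_norm X + frob_norm Y.
Proof.
rewrite -ler_sqr ?nnegrE ?addr_ge0 ?frob_norm_ge0//.
have := frob_inner_combo 1 1 X Y; rewrite !scale1r sqr_frob_norm => ->.
rewrite sqrrD !sqr_frob_norm; have := frob_inner_le X Y; lra.
Qed.

End Frobenius.

Lemma continuous_fin_sum {R : realType} (T : topologicalType) (I : finType)
    (f : I -> T -> R) :
  (forall i, continuous (f i)) -> continuous (fun x => \sum_i f i x).
Proof.
move=> cf x; rewrite /continuous_at.
elim: (index_enum I) => [|i s IH].
  under eq_fun do rewrite big_nil.
  by rewrite big_nil; exact: cvg_cst.
under eq_fun do rewrite big_cons.
by rewrite big_cons; apply: cvgD; [exact: cf|exact: IH].
Qed.

Section OrthogonalGroup.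
Context {R : realType} {r : nat}.
Implicit Types P Q : 'M[R]_r.

Definition orthogonal : set 'M[R]_r := [set Q | Q^T *m Q = 1%:M].

Lemma orthogonal1 : orthogonal 1%:M.
Proof. by rewrite /orthogonal /= trmx1 mul1mx. Qed.

Lemma orthogonalM P Q : orthogonal P -> orthogonal Q -> orthogonal (P *m Q).
Proof.
rewrite /orthogonal /= => PO QO.
by rewrite trmx_mul mulmxA -(mulmxA Q^T) PO mulmx1.
Qed.

Lemma orthogonalK Q : orthogonal Q -> Q *m Q^T = 1%:M.
Proof. exact: mulmx1C. Qed.

Lemma orthogonalV Q : orthogonal Q -> orthogonal Q^T.
Proof. by move=> /orthogonalK; rewrite /orthogonal /= trmxK. Qed.

Lemma frob_norm_orthogonal n Q (X : 'M[R]_(r, n)) :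
  orthogonal Q -> frob_norm (Q *m X) = frob_norm X.
Proof.
move=> QO; rewrite /frob_norm /frob_inner trmx_mul mulmxA -(mulmxA X^T) QO.
by rewrite mulmx1.
Qed.

Lemma orthogonal_le1 Q i j : orthogonal Q -> `|Q i j| <= 1.
Proof.
move=> /matrixP /(_ j j); rewrite !mxE eqxx mulr1n (bigD1 i)//= mxE -expr2 => QO.
rewrite -(@expr_le1 _ 2)// real_normK ?num_real// -QO lerDl.
by apply: sumr_ge0 => k _; rewrite mxE -expr2 sqr_ge0.
Qed.

Lemma continuous_vec_mx_entry i j :
  continuous (fun v : 'rV[R]_(r * r) => vec_mx v i j).
Proof.
have -> : (fun v : 'rV[R]_(r * r) => vec_mx v i j) =
          (fun v => v ord0 (mxvec_index i j)).
  by apply/funext => v; rewrite mxE.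
exact: coord_continuous.
Qed.

Lemma compact_vec_orthogonal :
  compact [set v : 'rV[R]_(r * r) | orthogonal (vec_mx v)].
Proof.
apply: bounded_closed_compact.
  exists 1; split=> // M M1 v vO.
  rewrite /Num.norm /= mx_normrE; apply: bigmax_le; first exact: (le_trans ler01 (ltW M1)).
  case=> a k _ /=; rewrite (ord1 a); case/mxvec_indexP: k => i j.
  have := orthogonal_le1 i j vO; rewrite mxE => /le_trans; apply; exact: ltW.
have -> : [set v : 'rV[R]_(r * r) | orthogonal (vec_mx v)] =
    \bigcap_(i in [set: 'I_r]) \bigcap_(j in [set: 'I_r])
      (fun v : 'rV[R]_(r * r) => \sum_k vec_mx v k i * vec_mx v k j)
        @^-1` [set (1%:M : 'M[R]_r) i j].
  have entry (v : 'rV[R]_(r * r)) i j :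
      ((vec_mx v)^T *m vec_mx v) i j = \sum_k vec_mx v k i * vec_mx v k j.
    by rewrite mxE; apply: eq_bigr => k _; rewrite mxE.
  apply/seteqP; split=> v /= vO.
    by move=> i _ j _ /=; rewrite -entry vO.
  by apply/matrixP => i j; rewrite entry; exact: vO.
apply: closed_bigI => i _; apply: closed_bigI => j _.
apply: closed_comp; last exact: closed_eq.
move=> v _; apply: continuous_fin_sum => k w.
exact: (cvgM (@continuous_vec_mx_entry k i w) (@continuous_vec_mx_entry k j w)).
Qed.

End OrthogonalGroup.
Arguments orthogonal R r : clear implicits.

Section OrbitDistance.
Context {R : realType} {r n : nat}.
Implicit Types (X Y Z : 'M[R]_(r, n)) (Q : 'M[R]_r).

(* The infimum is a minimum: see [orbit_dist_min]. *)
Definition orbit_dist X Y : R :=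
  inf [set frob_norm (Q *m X - Y) | Q in orthogonal R r].

Lemma orbit_dist_le Q X Y :
  orthogonal R r Q -> orbit_dist X Y <= frob_norm (Q *m X - Y).
Proof.
move=> QO; apply: ge_inf; last by exists Q.
by exists 0 => _ [P _ <-]; exact: frob_norm_ge0.
Qed.

Lemma orbit_dist_min X Y :
  exists2 Q, orthogonal R r Q & orbit_dist X Y = frob_norm (Q *m X - Y).
Proof.
pose f (v : 'rV[R]_(r * r)) := frob_norm (vec_mx v *m X - Y).
have cf : continuous f.
  suff ci : continuous (fun v : 'rV[R]_(r * r) =>
      frob_inner (vec_mx v *m X - Y) (vec_mx v *m X - Y)).
    by move=> v; exact: (continuous_comp (ci v) (@sqrt_continuous R _)).
  have -> : (fun v : 'rV[R]_(r * r) =>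
      frob_inner (vec_mx v *m X - Y) (vec_mx v *m X - Y)) =
    (fun v => \sum_j \sum_i ((\sum_k vec_mx v i k * X k j) - Y i j) *
                            ((\sum_k vec_mx v i k * X k j) - Y i j)).
    apply/funext => w; rewrite frob_innerE; apply: eq_bigr => j _.
    by apply: eq_bigr => i _; rewrite !mxE.
  apply: continuous_fin_sum => j; apply: continuous_fin_sum => i.
  have c : continuous (fun v : 'rV[R]_(r * r) =>
      \sum_k vec_mx v i k * X k j - Y i j).
    have cs : continuous (fun v : 'rV[R]_(r * r) =>
        \sum_k vec_mx v i k * X k j).
      apply: continuous_fin_sum => k u.
      exact: (cvgM (@continuous_vec_mx_entry _ _ i k u) (cvg_cst _)).
    by move=> w; exact: (cvgB (cs w) (cvg_cst _)).
  by move=> w; exact: (cvgM (c w) (c w)).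
have [|v] := EVT_min_rV _ (@compact_vec_orthogonal R r) (continuous_subspaceT cf).
  by exists (mxvec 1%:M); rewrite /= mxvecK; exact: orthogonal1.
rewrite inE /= => vO vmin; exists (vec_mx v) => //.
apply/eqP; rewrite eq_le orbit_dist_le//=; apply: lb_le_inf.
  by exists (frob_norm (1%:M *m X - Y)), 1%:M => //; exact: orthogonal1.
move=> _ [Q QO <-]; have := vmin (mxvec Q); rewrite /f mxvecK; apply.
by rewrite inE /= mxvecK.
Qed.

Lemma orbit_dist_ge0 X Y : 0 <= orbit_dist X Y.
Proof. by have [Q _ ->] := orbit_dist_min X Y; exact: frob_norm_ge0. Qed.

Lemma orbit_distxx X : orbit_dist X X = 0.
Proof.
apply/eqP; rewrite eq_le orbit_dist_ge0 andbT.
by rewrite (le_trans (orbit_dist_le _ _ orthogonal1))// mul1mx subrr frob_norm0.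
Qed.

Lemma orbit_dist_sym X Y : orbit_dist X Y = orbit_dist Y X.
Proof.
suff le A B : orbit_dist A B <= orbit_dist B A by apply/eqP; rewrite eq_le !le.
have [Q QO ->] := orbit_dist_min B A.
rewrite (le_trans (orbit_dist_le _ _ (orthogonalV QO)))//.
rewrite -(frob_norm_orthogonal _ QO) mulmxBr mulmxA orthogonalK// mul1mx.
by rewrite -frob_normN opprB.
Qed.

Lemma orbit_dist_triangle Y X Z :
  orbit_dist X Z <= orbit_dist X Y + orbit_dist Y Z.
Proof.
have [P PO ->] := orbit_dist_min X Y; have [Q QO ->] := orbit_dist_min Y Z.
rewrite (le_trans (orbit_dist_le _ _ (orthogonalM QO PO)))//.
rewrite -(frob_norm_orthogonal (P *m X - Y) QO) (le_trans _ (ler_frob_normD _ _))//.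
by rewrite mulmxBr mulmxA addrA subrK.
Qed.

End OrbitDistance.

Section OrbitSpace.
Context (R : realType) (r n : nat).

Definition orbit_rel : rel 'M[R]_(r, n) :=
  fun X Y => `[< exists2 Q, orthogonal R r Q & Q *m X = Y >].

Lemma orbit_rel_equiv : equiv_class_of orbit_rel.
Proof.
split=> [X|X Y|Y X Z].
- by apply/asboolP; exists 1%:M; [exact: orthogonal1|rewrite mul1mx].
- have sym A B : orbit_rel A B -> orbit_rel B A.
    move=> /asboolP[Q QO <-]; apply/asboolP; exists Q^T; first exact: orthogonalV.
    by rewrite mulmxA QO mul1mx.
  by apply/idP/idP; exact: sym.
- move=> /asboolP[P PO <-] /asboolP[Q QO <-]; apply/asboolP.
  by exists (Q *m P); [exact: orthogonalM|rewrite mulmxA].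
Qed.

Canonical orbit_equiv := EquivRelPack orbit_rel_equiv.

Definition orbit_space := {eq_quot orbit_equiv}.

HB.instance Definition _ := Choice.on orbit_space.
HB.instance Definition _ := EqQuotient.on orbit_space.

End OrbitSpace.

(* Library matrices carry the sup norm; this alias carries the Frobenius
   metric instead. *)
Definition frob_mx (R : realType) (m n : nat) : Type := 'M[R]_(m, n).

Section FrobeniusMetric.
Context {R : realType} {m n : nat}.

Definition frob_dist (X Y : frob_mx R m n) : R :=
  frob_norm ((X : 'M[R]_(m, n)) - (Y : 'M[R]_(m, n))).

Lemma frob_distxx X : frob_dist X X = 0.
Proof. by rewrite /frob_dist subrr frob_norm0. Qed.

Lemma frob_dist_positivity X Y : frob_dist X Y = 0 -> X = Y.
Proof. by move=> /frob_norm_eq0/eqP; rewrite subr_eq0 => /eqP. Qed.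

Lemma frob_dist_sym X Y : frob_dist X Y = frob_dist Y X.
Proof. by rewrite /frob_dist -frob_normN opprB. Qed.

Lemma frob_dist_triangle Y X Z :
  frob_dist X Z <= frob_dist X Y + frob_dist Y Z.
Proof.
rewrite /frob_dist.
have -> : (X : 'M[R]_(m, n)) - (Z : 'M[R]_(m, n)) =
  ((X : 'M[R]_(m, n)) - (Y : 'M[R]_(m, n))) +
  ((Y : 'M[R]_(m, n)) - (Z : 'M[R]_(m, n))) by rewrite addrA subrK.
exact: ler_frob_normD.
Qed.

End FrobeniusMetric.

HB.instance Definition _ (R : realType) (m n : nat) :=
  Choice.copy (frob_mx R m n) 'M[R]_(m, n).
HB.instance Definition _ (R : realType) (m n : nat) :=
  @isMetric.Build R (frob_mx R m n) frob_dist frob_distxx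
    frob_dist_positivity frob_dist_sym frob_dist_triangle.

Section OrbitMetric.
Context {R : realType} {r n : nat}.
Implicit Types X Y : 'M[R]_(r, n).

Definition orbit_of X : orbit_space R r n := \pi X.

Lemma orbit_ofP X Y :
  reflect (exists2 Q, orthogonal R r Q & Q *m X = Y)
          (orbit_of X == orbit_of Y).
Proof.
apply: (iffP eqP) => [/eqmodP/asboolP//|XY].
by apply/eqmodP/asboolP.
Qed.

Lemma repr_orbit_of X :
  exists2 Q, orthogonal R r Q & Q *m X = repr (orbit_of X).
Proof. by apply/orbit_ofP; rewrite /orbit_of reprK. Qed.

Definition quot_dist (x y : orbit_space R r n) : R :=
  orbit_dist (repr x) (repr y).

Lemma quot_distE X Y : quot_dist (orbit_of X) (orbit_of Y) = orbit_dist X Y.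
Proof.
have inv (Z W : 'M[R]_(r, n)) Q : orthogonal R r Q -> orbit_dist (Q *m Z) W = orbit_dist Z W.
  move=> QO.
  have le (A B : 'M[R]_(r, n)) P : orthogonal R r P ->
      orbit_dist A B <= orbit_dist (P *m A) B.
    move=> PO; have [S SO ->] := orbit_dist_min (P *m A) B.
    by rewrite mulmxA; exact/orbit_dist_le/orthogonalM.
  apply/eqP; rewrite eq_le; apply/andP; split; last exact: le.
  rewrite (le_trans (le _ _ _ (orthogonalV QO)))//.
  by rewrite mulmxA QO mul1mx.
rewrite /quot_dist.
have [P PO <-] := repr_orbit_of X; have [Q QO <-] := repr_orbit_of Y.
by rewrite inv// orbit_dist_sym inv// orbit_dist_sym.
Qed.

Lemma quot_distxx x : quot_dist x x = 0.
Proof. exact: orbit_distxx. Qed.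

Lemma quot_dist_positivity x y : quot_dist x y = 0 -> x = y.
Proof.
rewrite /quot_dist; have [Q QO ->] := orbit_dist_min (repr x) (repr y).
move=> /frob_norm_eq0/eqP; rewrite subr_eq0 => /eqP Qxy.
rewrite -[x]reprK -[y]reprK; apply/eqP/(orbit_ofP (repr x) (repr y)).
by exists Q.
Qed.

Lemma quot_dist_sym x y : quot_dist x y = quot_dist y x.
Proof. exact: orbit_dist_sym. Qed.

Lemma quot_dist_triangle y x z :
  quot_dist x z <= quot_dist x y + quot_dist y z.
Proof. exact: orbit_dist_triangle. Qed.

End OrbitMetric.

HB.instance Definition _ (R : realType) (r n : nat) :=
  @isMetric.Build R (orbit_space R r n) quot_dist quot_distxx
    quot_dist_positivity quot_dist_sym quot_dist_triangle.

Lemma mdist_orbitE (R : realType) (r n : nat) (X Y : 'M[R]_(r, n)) :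
  mdist (orbit_of X) (orbit_of Y) = orbit_dist X Y.
Proof. exact: quot_distE. Qed.

Section GramRoot.
Context {R : realType}.

Definition psdmx {n} (S : 'M[R]_n) : Prop :=
  S^T = S /\ forall v : 'cV[R]_n, 0 <= (v^T *m S *m v) ord0 ord0.

(* The unique positive semidefinite square root of a positive semidefinite
   matrix; the default value 0 is only used when [A] has no such root. *)
Definition psd_sqrt {n} (A : 'M[R]_n) : 'M[R]_n :=
  xget 0 [set S : 'M[R]_n | psdmx S /\ S *m S = A].

Definition phi {r n} (X : 'M[R]_(r, n)) : 'M[R]_n := psd_sqrt (X^T *m X).

Definition phi_quot {r n} (x : orbit_space R r n) : frob_mx R n n :=
  phi (repr x).

Lemma phi_quotE r n (X : 'M[R]_(r, n)) : phi_quot (orbit_of X) = phi X.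
Proof.
rewrite /phi_quot; have [Q QO <-] := repr_orbit_of X; rewrite /phi trmx_mul.
by rewrite mulmxA -(mulmxA X^T) QO mulmx1.
Qed.

End GramRoot.

Definition is_hilbert (R : realType) (H : completeNormedModType R) : Prop :=
  exists ip : {dot H for @idfun R}, forall x : H, ip x x = `|x| ^+ 2.

(* Normed modules do not come with a [metricType] structure. *)
Definition norm_metric (R : realType) (H : normedModType R) : Type := H.

Section NormMetric.
Context {R : realType} {H : normedModType R}.

Definition norm_dist (x y : norm_metric H) : R := `|(x : H) - (y : H)|.

Lemma norm_distxx x : norm_dist x x = 0.
Proof. by rewrite /norm_dist subrr normr0. Qed.

Lemma norm_dist_positivity x y : norm_dist x y = 0 -> x = y.
Proof. by move=> /eqP; rewrite normr_eq0 subr_eq0 => /eqP. Qed.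

Lemma norm_dist_sym x y : norm_dist x y = norm_dist y x.
Proof. exact: distrC. Qed.

Lemma norm_dist_triangle y x z :
  norm_dist x z <= norm_dist x y + norm_dist y z.
Proof. exact: ler_distD. Qed.

End NormMetric.

HB.instance Definition _ (R : realType) (H : normedModType R) :=
  Choice.copy (norm_metric H) H.
HB.instance Definition _ (R : realType) (H : normedModType R) :=
  @isMetric.Build R (norm_metric H) norm_dist norm_distxx
    norm_dist_positivity norm_dist_sym norm_dist_triangle.

Section Distortion.
Context {R : realType}.
Local Open Scope ereal_scope.

(* In [\bar R], 0 * +oo = 0. *)
Definition lower_lip {X Y : metricType R} (f : X -> Y) : \bar R :=
  ereal_sup [set a | 0 <= a /\
    forall x y, a * (mdist x y)%:E <= (mdist (f x) (f y))%:E].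

Definition upper_lip {X Y : metricType R} (f : X -> Y) : \bar R :=
  ereal_inf [set b | 0 <= b /\
    forall x y, (mdist (f x) (f y))%:E <= b * (mdist x y)%:E].

Lemma lower_lip_max (X Y : metricType R) (f : X -> Y) : 0 <= lower_lip f /\
  forall x y, lower_lip f * (mdist x y)%:E <= (mdist (f x) (f y))%:E.
Proof.
have L0 : 0 <= lower_lip f.
  by apply: ereal_sup_ubound; split=> // x y; rewrite mul0e lee_fin mdist_ge0.
split=> // x y; have [->|xy] := eqVneq x y.
  by rewrite !mdistxx mule0.
have d0 : (0 < mdist x y)%R by rewrite mdist_gt0.
rewrite -lee_pdivlMr//; apply: ge_ereal_sup => a [a0 /(_ x y)].
by rewrite lee_pdivlMr.
Qed.

Lemma upper_lip_min (X Y : metricType R) (f : X -> Y) : 0 <= upper_lip f /\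
  forall x y, (mdist (f x) (f y))%:E <= upper_lip f * (mdist x y)%:E.
Proof.
split=> [|x y]; first by apply: le_ereal_inf_tmp => b [].
have [->|xy] := eqVneq x y; first by rewrite !mdistxx mule0.
have d0 : (0 < mdist x y)%R by rewrite mdist_gt0.
rewrite -lee_pdivrMr//; apply: le_ereal_inf_tmp => b [b0 /(_ x y)].
by rewrite lee_pdivrMr.
Qed.

Definition distortion {X Y : metricType R} (f : X -> Y) : \bar R :=
  if (lower_lip f == 0) || (upper_lip f == +oo) then +oo
  else upper_lip f / lower_lip f.

Definition euclidean_distortion (X : metricType R) : \bar R :=
  ereal_inf [set c | exists H : completeNormedModType R,
    is_hilbert H /\ exists f : X -> norm_metric H, distortion f = c].

End Distortion.

(* Main.v *)
Require Import Defs.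
From HB Require Import structures.
From mathcomp Require Import all_boot all_order all_algebra ring lra.
From mathcomp Require Import all_classical all_reals all_analysis.

(* Squared distances are governed by inner products: d(X, Y) is computed by the
   orthogonal Q maximizing <QX, Y>, and the first-order conditions at Q (along
   rotations and reflections) say that Q X Y^T is positive semidefinite.  Applied
   with Y = 1 this yields square roots, and with X^T X = Y^T Y it yields Q X = Y,
   hence a polar decomposition X = A phi(X) after padding X by zeros.  The lower
   bound becomes <phi(X), phi(Y)> <= tr (X Y^T) when X Y^T >= 0, and the upper
   bound is the Araki-Yamagami inequality
   4 <X, Y> <= |X|^2 + |Y|^2 + 2 <phi(X), phi(Y)>, proved by Cauchy-Schwarz on
   factors of phi(X) and phi(Y).

   For the Euclidean distortion, send 2^(l+2) equally spaced points of a half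
   circle, a closed polygon in the quotient, to a Hilbert space.  Opposite points
   are at squared distance 2 in the quotient, neighbours at squared distance at
   most 2 - 2 cos t, and a discrete Wirtinger inequality bounds the squared
   diagonals of a closed polygon by its squared sides; letting t tend to 0 forces
   distortion at least sqrt 2.  As phi takes values in a Hilbert space, this also
   gives the sharpness of its upper Lipschitz constant. *)

Set Implicit Arguments.
Unset Strict Implicit.
Unset Printing Implicit Defensive.

Import Defs.
Import Order.TTheory GRing.Theory Num.Theory.
Import numFieldNormedType.Exports.
Local Open Scope classical_set_scope.
Local Open Scope ring_scope.

(** * Adjoints and polarization for the Frobenius inner product *)

Section FrobInner.
Context {R : realType}.

Lemma frob_innerMl m n p (A : 'M[R]_(p, m)) (X : 'M[R]_(m, n)) Y :
  frob_inner (A *m X) Y = frob_inner X (A^T *m Y).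
Proof. by rewrite /frob_inner trmx_mul mulmxA. Qed.

Lemma frob_innerMr m n p (A : 'M[R]_(n, p)) (X : 'M[R]_(m, n)) Y :
  frob_inner (X *m A) Y = frob_inner X (Y *m A^T).
Proof. by rewrite /frob_inner trmx_mul -mulmxA mxtrace_mulC mulmxA. Qed.

Lemma sqr_frob_normB m n (X Y : 'M[R]_(m, n)) :
  frob_norm (X - Y) ^+ 2 =
  frob_norm X ^+ 2 + frob_norm Y ^+ 2 - 2 * frob_inner X Y.
Proof.
rewrite !sqr_frob_norm; have := frob_inner_combo 1 (-1) X Y.
by rewrite scale1r scaleN1r => ->; ring.
Qed.

Lemma frob_inner_half m n (X Y : 'M[R]_(m, n)) :
  2 * frob_inner X Y <= frob_norm X ^+ 2 + frob_norm Y ^+ 2.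
Proof. by rewrite -subr_ge0 -sqr_frob_normB sqr_ge0. Qed.

End FrobInner.

(** * Positive semidefinite matrices: Cholesky factors and uniqueness of square roots *)

Section Psd.
Context {R : realType}.

Lemma psdmx_gram m n (p : 'M[R]_(m, n)) : psdmx (p^T *m p).
Proof.
split=> [|v]; first by rewrite trmx_mul trmxK.
rewrite mulmxA -mulmxA -trmx_mul mxE; apply: sumr_ge0 => i _.
by rewrite mxE -expr2 sqr_ge0.
Qed.

Lemma trmx11 (A : 'M[R]_1) : A^T = A.
Proof. by apply/matrixP => i j; rewrite !ord1 mxE. Qed.

(** Induction on the size, splitting off the first row and column: a zero pivot forces its row to
    vanish, and a positive pivot leaves a positive semidefinite Schur complement. *)
Lemma psdmx_cholesky n (S : 'M[R]_n) : psdmx S -> exists p : 'M[R]_n, S = p^T *m p.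
Proof.
elim: n S => [|n IH] S; first by exists 0; rewrite [LHS]flatmx0 [RHS]flatmx0.
suff block (a : 'M[R]_1) (b : 'rV[R]_n) (b' : 'cV[R]_n) (C : 'M[R]_n) :
    psdmx (block_mx a b b' C) ->
    exists p : 'M[R]_(1 + n), block_mx a b b' C = p^T *m p.
  by rewrite -[S](@submxK _ 1 n 1 n); exact: block.
case; rewrite tr_block_mx => /eq_block_mx[_ _ b'b Csym] pos.
move: pos; rewrite -b'b => pos {b' b'b}.
have addE (A B : 'M[R]_1) : (A + B) ord0 ord0 = A ord0 ord0 + B ord0 ord0.
  by rewrite mxE.
have scaleE c (A : 'M[R]_1) : (c *: A) ord0 ord0 = c * A ord0 ord0.
  by rewrite mxE.
have quad (t : R) (w : 'cV[R]_n) : 0 <= a ord0 ord0 * t ^+ 2 +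
    2 * t * (b *m w) ord0 ord0 + (w^T *m C *m w) ord0 ord0.
  have := pos (col_mx t%:M w).
  rewrite tr_col_mx mul_row_block mul_row_col !mulmxDl addrACA -addrA.
  rewrite -trmx_mul (trmx11 (b *m w)) tr_scalar_mx.
  rewrite !(mul_scalar_mx, mul_mx_scalar) -scalemxAl.
  rewrite !addE !scaleE.
  by move=> h; apply: le_trans h _; rewrite le_eqVlt; apply/orP; left; apply/eqP; ring.
have a0 : 0 <= a ord0 ord0.
  by have := quad 1 0; rewrite !mulmx0 !mxE expr1n mulr1 mulr0 !addr0.
have [a_eq0|a_neq0] := eqVneq (a ord0 ord0) 0.
  have b0 : b = 0.
    apply: trmx_inj; rewrite trmx0; apply: frob_inner_eq0.
    rewrite /frob_inner trmxK trace_mx11.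
    set s := _ ord0 ord0; apply/eqP; apply: contraT => s0.
    set c := ((b^T)^T *m C *m b^T) ord0 ord0.
    (* For a zero pivot the form is affine in [t]; this choice would give it the value -1. *)
    have := quad (- (c + 1) / (2 * s)) b^T; rewrite a_eq0 mul0r add0r -/c -/s.
    have -> : 2 * (- (c + 1) / (2 * s)) * s + c = -1 by field; rewrite s0.
    by rewrite ler0N1.
  have [|p ->] := IH C.
    by split=> // w; have := quad 0 w; rewrite expr0n !mulr0 mul0r !add0r.
  exists (block_mx 0 0 0 p); rewrite b0 tr_block_mx mulmx_block !trmx0.
  rewrite !(mul0mx, mulmx0) !add0r [a]mx11_scalar a_eq0.
  by rewrite -scalemx1 scale0r.
have a_gt0 : 0 < a ord0 ord0 by rewrite lt_neqAle eq_sym a_neq0.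
have [|p Cp] := IH (C - (a ord0 ord0)^-1 *: (b^T *m b)).
  split=> [|w].
    by rewrite linearB /= Csym linearZ /= trmx_mul trmxK.
  (* This [t] minimizes the form for fixed [w]; the minimum is the form of the Schur complement. *)
  have := quad (- (b *m w) ord0 ord0 / a ord0 ord0) w.
  rewrite mulmxBr mulmxBl -scalemxAr -scalemxAl mulmxA -trmx_mul -mulmxA trmx11.
  rewrite -scaleNr addE scaleE -[b *m w *m b *m w]mulmxA; move: (b *m w) => q.
  have -> : (q *m q) ord0 ord0 = q ord0 ord0 ^+ 2 by rewrite mxE big_ord1.
  by apply: etrans; congr (0 <= _); field.
set c := Num.sqrt (a ord0 ord0).
have c0 : c != 0 by rewrite sqrtr_eq0 -ltNge.
exists (block_mx c%:M (c^-1 *: b) 0 p); rewrite tr_block_mx mulmx_block trmx0.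
rewrite !(mul0mx, mulmx0) !addr0 -Cp tr_scalar_mx [(c^-1 *: b)^T]linearZ /=.
rewrite -!(scalemxAl, scalemxAr) mul_scalar_mx mul_mx_scalar mul_scalar_mx !scalerA.
rewrite mulVf// !scale1r scale_scalar_mx -expr2 -invfM -expr2 sqr_sqrtr//.
by rewrite [a in LHS]mx11_scalar addrC subrK.
Qed.

(** With [D = P - S], equality of the squares gives [(P + S) D + D (P + S) = 0], hence
    [tr (D P D) + tr (D S D) = 0]. Both terms are nonnegative, so [P D = S D = 0] and [D D = 0]. *)
Lemma psdmx_sqrt_unique n (P S : 'M[R]_n) :
  psdmx P -> psdmx S -> P *m P = S *m S -> P = S.
Proof.
move=> psdP psdS PS.
have [p Pp] := psdmx_cholesky psdP; have [s Ss] := psdmx_cholesky psdS.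
set D := P - S.
have DT : D^T = D by rewrite linearB /= psdP.1 psdS.1.
have tr0 : \tr (D *m P *m D) + \tr (D *m S *m D) = 0.
  have : \tr (D *m ((P + S) *m D + D *m (P + S))) = 0.
    rewrite (_ : _ + _ = 0) ?mulmx0 ?mxtrace0// /D !(mulmxDl, mulmxDr, mulmxN, mulNmx).
    move: (P *m S) (S *m P) => A B; rewrite PS.
    by apply/matrixP => i j; rewrite !mxE; ring.
  rewrite mulmxDr mxtraceD [\tr (D *m (D *m _))]mxtrace_mulC !mulmxA.
  by rewrite -mxtraceD -mulmxDl -mulmxDr -mulr2n => /eqP; rewrite mulrn_eq0 => /eqP.
have ge0 (q : 'M[R]_n) : \tr (D *m (q^T *m q) *m D) = frob_inner (q *m D) (q *m D).
  by rewrite /frob_inner trmx_mul DT !mulmxA.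
have pD0 : P *m D = 0.
  rewrite Pp -mulmxA (_ : p *m D = 0) ?mulmx0//; apply: frob_inner_eq0.
  have := frob_inner_ge0 (p *m D); have := frob_inner_ge0 (s *m D).
  by move: tr0; rewrite Pp Ss !ge0; lra.
have sD0 : S *m D = 0.
  rewrite Ss -mulmxA (_ : s *m D = 0) ?mulmx0//; apply: frob_inner_eq0.
  have := frob_inner_ge0 (p *m D); have := frob_inner_ge0 (s *m D).
  by move: tr0; rewrite Pp Ss !ge0; lra.
apply/eqP; rewrite -subr_eq0; apply/eqP/frob_inner_eq0.
by rewrite /frob_inner -/D DT {1}/D mulmxBl pD0 sD0 subrr mxtrace0.
Qed.
End Psd.

(** * Optimal alignment, polar decomposition and the two Lipschitz bounds *)

Section Optimal.
Context {R : realType}.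

(** Rodrigues' rotation formula, with [s] the sine and [u] one minus the cosine of the angle; the
    relation between them is the equation of the unit circle. *)
Lemma orthogonal_rodrigues r (J : 'M[R]_r) s u :
  J^T = - J -> J *m J *m J = - J -> s ^+ 2 + u ^+ 2 = 2 * u ->
  orthogonal R r (1%:M + s *: J + u *: (J *m J)).
Proof.
move=> JT JJJ su; rewrite /orthogonal /=.
rewrite !raddfD /= trmx1 ![(_ *: _)^T]linearZ /= trmx_mul JT mulmxN mulNmx opprK scalerN.
rewrite !(mulmxDl, mulmxDr, mulmxN, mulNmx, mulmx1, mul1mx) -!(scalemxAl, scalemxAr).
rewrite !mulmxA !(mulNmx, JJJ); move: (J *m J) => J2.
have s2 : s ^+ 2 = 2 * u - u ^+ 2 by rewrite -su addrK.
by apply/matrixP => k l; rewrite !mxE; ring: s2.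
Qed.

(** First-order condition along rotations in the plane of coordinates [i] and [j], whose generator
    [J] satisfies [tr (J M) = M j i - M i j]. *)
Lemma trace_max_sym r (M : 'M[R]_r) :
  (forall Q, orthogonal R r Q -> \tr (Q *m M) <= \tr M) -> M^T = M.
Proof.
move=> maxM; apply/matrixP => i j; rewrite mxE.
have [->//|ij] := eqVneq i j.
have [J JE] : exists J : 'M[R]_r, J = delta_mx i j - delta_mx j i by eexists.
have JT : J^T = - J by rewrite JE linearB /= !trmx_delta opprB.
have JJJ : J *m J *m J = - J.
  rewrite JE !(mulmxBl, mulmxBr) !mul_delta_mx_cond [j == i]eq_sym (negbTE ij) !eqxx.
  rewrite !(mulr0n, mulr1n, sub0r, subr0, mulmx0, mul0mx, mulNmx) !mul_delta_mx_cond.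
  rewrite [j == i]eq_sym (negbTE ij) !eqxx !(mulr0n, mulr1n, subr0).
  by rewrite oppr0 sub0r opprB opprK addrC.
have trJ : \tr (J *m M) = M j i - M i j.
  rewrite JE mulmxBl linearB /=; congr (_ - _); rewrite /mxtrace.
    rewrite (bigD1 i)//= big1 ?addr0 => [|k ki].
      rewrite mxE (bigD1 j)//= big1 ?addr0 => [|k kj].
        by rewrite mxE !eqxx mul1r.
      by rewrite mxE (negbTE kj) andbF mul0r.
    by rewrite mxE big1// => l _; rewrite mxE (negbTE ki) mul0r.
  rewrite (bigD1 j)//= big1 ?addr0 => [|k kj].
    rewrite mxE (bigD1 i)//= big1 ?addr0 => [|k ki].
      by rewrite mxE !eqxx mul1r.
    by rewrite mxE (negbTE ki) andbF mul0r.
  by rewrite mxE big1// => l _; rewrite mxE (negbTE kj) mul0r.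
set a := \tr (J *m J *m M).
apply/eqP; rewrite -subr_eq0 -trJ; apply: contraT => b0.
set b := \tr (J *m M) in b0.
(* The first-order effect of a rotation by a small angle has the sign of [b]. *)
pose t := b / (1 + `|a|).
have a1 : 0 < 1 + `|a| by rewrite ltr_pwDl.
have t2 : 0 < 1 + t ^+ 2 by rewrite ltr_pwDl ?sqr_ge0.
(* Here [t] is the tangent of half the angle, which parametrizes the circle rationally. *)
have [|] := boolP ((2 * t / (1 + t ^+ 2)) ^+ 2 + (2 * t ^+ 2 / (1 + t ^+ 2)) ^+ 2
  == 2 * (2 * t ^+ 2 / (1 + t ^+ 2))); last first.
  by move=> /negP[]; apply/eqP; field; exact: lt0r_neq0.
move=> /eqP/(orthogonal_rodrigues JT JJJ)/maxM.
rewrite !mulmxDl mul1mx -!scalemxAl !mxtraceD !mxtraceZ.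
rewrite -/a -/b -addrA gerDl. 
(* The change of the trace is a positive multiple of [b ^+ 2 * (1 + |a| + a)], which is positive,
   against maximality. *)
have -> : 2 * t / (1 + t ^+ 2) * b + 2 * t ^+ 2 / (1 + t ^+ 2) * a =
    2 / (1 + t ^+ 2) / (1 + `|a|) ^+ 2 * (b ^+ 2 * (1 + `|a| + a)).
  by rewrite {1 3}/t; field; rewrite !lt0r_neq0.
rewrite pmulr_rle0 ?divr_gt0 ?exprn_gt0//.
rewrite pmulr_rle0 ?exprn_even_gt0// leNgt.
move=> /negP[]; have := ler_norm (- a); rewrite normrN; lra.
Qed.

(** The reflection along [v] lowers the trace by [2 / q] times the quadratic form of [M] at [v], so
    maximality makes that form nonnegative. *)
Lemma trace_max_psd r (M : 'M[R]_r) :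
  (forall Q, orthogonal R r Q -> \tr (Q *m M) <= \tr M) -> psdmx M.
Proof.
move=> maxM; split=> [|v]; first exact: trace_max_sym.
have [->|v0] := eqVneq v 0; first by rewrite mulmx0 mxE.
set q := frob_inner v v.
have q0 : 0 < q.
  rewrite lt_neqAle frob_inner_ge0 andbT eq_sym.
  by apply: contra v0 => /eqP /frob_inner_eq0 ->.
have vv : v^T *m v = q%:M by rewrite [LHS]mx11_scalar -trace_mx11.
pose H : 'M[R]_r := 1%:M - (2 / q) *: (v *m v^T).
have HO : orthogonal R r H.
  rewrite /orthogonal /= /H [(_ - _)^T]linearB /= trmx1.
  rewrite [(_ *: _)^T]linearZ /= trmx_mul trmxK.
  rewrite mulmxBl !mulmxBr !mul1mx mulmx1 -scalemxAl -!scalemxAr.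
  rewrite -mulmxA (mulmxA v^T) vv mul_scalar_mx -scalemxAr !scalerA.
  apply/matrixP => i j; rewrite !mxE; field; exact: lt0r_neq0.
have := maxM H HO.
rewrite mulmxBl mul1mx linearB /= -scalemxAl mxtraceZ gerBl pmulr_rge0 ?divr_gt0//.
by rewrite -(mulmxA v) mxtrace_mulC -trace_mx11.
Qed.

Lemma frob_inner_tr m n (X Y : 'M[R]_(m, n)) : frob_inner X Y = \tr (X *m Y^T).
Proof. by rewrite frob_inner_sym /frob_inner mxtrace_mulC. Qed.

(** Orthogonal maps preserve norms, so a minimizing [Q] maximizes the inner product of [Q X] and
    [Y], and no further [P] can raise the trace of [Q X Y^T]. *)
Lemma orbit_dist_psd r n (X Y : 'M[R]_(r, n)) : exists2 Q, orthogonal R r Q &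
  orbit_dist X Y = frob_norm (Q *m X - Y) /\ psdmx (Q *m X *m Y^T).
Proof.
have [Q QO XY] := orbit_dist_min X Y; exists Q => //; split=> //.
apply: trace_max_psd => P PO; rewrite mulmxA -!frob_inner_tr.
have := orbit_dist_le X Y (orthogonalM PO QO).
rewrite XY -ler_sqr ?nnegrE ?frob_norm_ge0// !sqr_frob_normB -mulmxA.
by rewrite !frob_norm_orthogonal//; lra.
Qed.

(** Aligning a Cholesky factor [Z] with the identity makes [Q Z] positive semidefinite, in
    particular symmetric, so its square is [Z^T Z]. *)
Lemma psdmx_gram_sqrt m n (X : 'M[R]_(m, n)) :
  exists2 P : 'M[R]_n, psdmx P & P *m P = X^T *m X.
Proof.
have [Z XZ] := psdmx_cholesky (psdmx_gram X).
have [Q QO [_]] := orbit_dist_psd Z 1%:M; rewrite trmx1 mulmx1 => psdQZ.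
exists (Q *m Z) => //.
by rewrite -{1}psdQZ.1 trmx_mul -mulmxA (mulmxA Q^T) QO mul1mx XZ.
Qed.

Lemma phi_orthogonal r n (Q : 'M[R]_r) (X : 'M[R]_(r, n)) :
  orthogonal R r Q -> phi (Q *m X) = phi X.
Proof. by move=> QO; rewrite /phi trmx_mul -mulmxA (mulmxA Q^T) QO mul1mx. Qed.

(** A Gram matrix has a positive semidefinite root, so [xget] never falls back to its default value
    here. *)
Lemma phi_psd m n (X : 'M[R]_(m, n)) : psdmx (phi X).
Proof.
rewrite /phi /psd_sqrt; set B := [set S | _].
have [P psdP PX] := psdmx_gram_sqrt X.
by have [] : B (xget 0 B) by apply: xgetPex; exists P.
Qed.

Lemma phi_sqr m n (X : 'M[R]_(m, n)) : phi X *m phi X = X^T *m X.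
Proof.
rewrite {1 2}/phi /psd_sqrt; set B := [set S | _].
have [P psdP PX] := psdmx_gram_sqrt X.
by have [] : B (xget 0 B) by apply: xgetPex; exists P.
Qed.

(** For the aligned [C = Q A], both [C B^T] and [C C^T] are positive semidefinite with the same
    square, hence equal; then the squared norm of [C - B] expands to 0. *)
Lemma gram_eq_orthogonal m n (A B : 'M[R]_(m, n)) :
  A^T *m A = B^T *m B -> exists2 Q, orthogonal R m Q & Q *m A = B.
Proof.
move=> AB; have [Q QO [_ psdM]] := orbit_dist_psd A B; exists Q => //.
set C := Q *m A in psdM.
have CB : C^T *m C = B^T *m B by rewrite -AB /C trmx_mul -mulmxA (mulmxA Q^T) QO mul1mx.
have M2 : C *m B^T = C *m C^T.
  apply: psdmx_sqrt_unique => //; first by rewrite -{1}[C]trmxK; exact: psdmx_gram.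
  rewrite -{2}psdM.1 trmx_mul trmxK -mulmxA (mulmxA B^T) -CB.
  by rewrite !mulmxA.
apply/eqP; rewrite -subr_eq0; apply/eqP/frob_norm_eq0/eqP.
rewrite -sqrf_eq0 sqr_frob_normB !sqr_frob_norm; apply/eqP.
have -> : frob_inner B B = frob_inner C C by rewrite /frob_inner CB.
by rewrite [frob_inner C B]frob_inner_tr M2 -frob_inner_tr; ring.
Qed.

(* The isometry [A] completes the polar decomposition of [X] padded by zeros. *)
Lemma polar_isometry r n (X : 'M[R]_(r, n)) : exists A : 'M[R]_(r + n, n),
  A^T *m A = 1%:M /\ A *m phi X = col_mx X 0.
Proof.
pose E := col_mx (0 : 'M[R]_(r, n)) 1%:M.
(* Both padded matrices have Gram matrix [X^T *m X]; [r + n] rows leave room for an isometry even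
   when [r < n]. *)
have [|Q QO QX] := @gram_eq_orthogonal _ _ (E *m phi X) (col_mx X 0).
  rewrite !mul_col_mx !tr_col_mx !mul_row_col !mul0mx mul1mx !trmx0 !mul0mx add0r addr0.
  by rewrite (phi_psd X).1 phi_sqr.
exists (Q *m E); rewrite -mulmxA QX; split=> //.
rewrite trmx_mul -mulmxA (mulmxA Q^T) QO mul1mx tr_col_mx mul_row_col.
by rewrite trmx0 mul0mx add0r trmx1 mulmx1.
Qed.

Lemma frob_norm_phi m n (X : 'M[R]_(m, n)) : frob_norm (phi X) = frob_norm X.
Proof. by rewrite /frob_norm /frob_inner (phi_psd X).1 phi_sqr. Qed.

Lemma frob_norm_isometry m n p (A : 'M[R]_(m, n)) (X : 'M[R]_(n, p)) :
  A^T *m A = 1%:M -> frob_norm (A *m X) = frob_norm X.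
Proof. by move=> AA; rewrite /frob_norm frob_innerMl mulmxA AA mul1mx. Qed.

Lemma frob_norm_trmx m n (X : 'M[R]_(m, n)) : frob_norm X^T = frob_norm X.
Proof. by rewrite /frob_norm frob_inner_tr trmxK. Qed.

(** [A *m A^T] is the orthogonal projection onto the range of [A], and the squared distance from [X]
    to its projection is nonnegative. *)
Lemma frob_norm_coisometry m n p (A : 'M[R]_(m, n)) (X : 'M[R]_(m, p)) :
  A^T *m A = 1%:M -> frob_norm (A^T *m X) <= frob_norm X.
Proof.
move=> AA; rewrite -ler_sqr ?nnegrE ?frob_norm_ge0//.
have := sqr_ge0 (frob_norm (A *m (A^T *m X) - X)).
by rewrite sqr_frob_normB frob_norm_isometry// frob_innerMl -sqr_frob_norm; lra.
Qed.

Lemma frob_inner_col0 r n k (X Y : 'M[R]_(r, n)) :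
  frob_inner (col_mx X (0 : 'M[R]_(k, n))) (col_mx Y 0) = frob_inner X Y.
Proof.
by rewrite !frob_inner_tr tr_col_mx mul_col_row mxtrace_block trmx0 mulmx0 mxtrace0 addr0.
Qed.

Lemma sqr_frob_norm_mul_trmx k l n (p : 'M[R]_(k, n)) (q : 'M[R]_(l, n)) :
  frob_norm (p *m q^T) ^+ 2 = frob_inner (p^T *m p) (q^T *m q).
Proof.
rewrite sqr_frob_norm frob_innerMl mulmxA frob_inner_sym frob_innerMr.
by rewrite trmxK.
Qed.

(** Factoring the padded [X Y^T] as [s' s'^T], the left side is the inner product of [A^T s'] and
    [B^T s']. By Cauchy-Schwarz and contraction it is at most the squared norm of [s'], which is the
    trace of [X Y^T]. *)
Lemma frob_inner_phi_le r n (X Y : 'M[R]_(r, n)) :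
  psdmx (X *m Y^T) -> frob_inner (phi X) (phi Y) <= frob_inner X Y.
Proof.
move=> /psdmx_cholesky[s XYs].
have [A [AA AX]] := polar_isometry X; have [B [BB BY]] := polar_isometry Y.
pose s' := col_mx s^T (0 : 'M[R]_(n, r)).
have XYs' : col_mx X 0 *m (col_mx Y 0)^T = s' *m s'^T.
  by rewrite !tr_col_mx !mul_col_row !trmx0 !mulmx0 !mul0mx XYs trmxK.
have -> : phi X = A^T *m col_mx X 0 by rewrite -AX mulmxA AA mul1mx.
have -> : phi Y = B^T *m col_mx Y 0 by rewrite -BY mulmxA BB mul1mx.
rewrite frob_inner_tr trmx_mul trmxK mulmxA -(mulmxA A^T) XYs'.
have -> : \tr (A^T *m (s' *m s'^T) *m B) = frob_inner (A^T *m s') (B^T *m s').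
  by rewrite frob_inner_tr trmx_mul trmxK !mulmxA.
have -> : frob_inner X Y = frob_norm s' ^+ 2.
  by rewrite -(frob_inner_col0 n X Y) frob_inner_tr XYs' -frob_inner_tr sqr_frob_norm.
apply: le_trans (frob_inner_le _ _) _.
by rewrite expr2 ler_pM ?frob_norm_ge0 ?frob_norm_coisometry.
Qed.

(** Once [X] is optimally aligned, the norms agree on both sides and only inner products remain to
    be compared. *)
Lemma orbit_dist_le_phi r n (X Y : 'M[R]_(r, n)) :
  orbit_dist X Y <= frob_norm (phi X - phi Y).
Proof.
have [Q QO [-> psdQ]] := orbit_dist_psd X Y.
rewrite -ler_sqr ?nnegrE ?frob_norm_ge0// !sqr_frob_normB.
have := frob_inner_phi_le psdQ; rewrite phi_orthogonal// frob_norm_orthogonal//.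
by rewrite !frob_norm_phi; lra.
Qed.

Lemma frob_norm_phiB_le r n (X Y : 'M[R]_(r, n)) :
  frob_norm (phi X - phi Y) ^+ 2 <= 2 * frob_norm (X - Y) ^+ 2.
Proof.
have [A [AA AX]] := polar_isometry X; have [B [BB BY]] := polar_isometry Y.
have XY : frob_inner X Y = frob_inner (A *m phi X) (B *m phi Y).
  by rewrite AX BY frob_inner_col0.
rewrite !sqr_frob_normB XY -(frob_norm_phi X) -(frob_norm_phi Y).
have [p Pp] := psdmx_cholesky (phi_psd X); have [s Ss] := psdmx_cholesky (phi_psd Y).
move: AX BY => _ _; rewrite {}Pp {}Ss {XY}.
have -> : frob_inner (A *m (p^T *m p)) (B *m (s^T *m s)) =
    frob_inner (p *m s^T) ((p *m A^T) *m (s *m B^T)^T).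
  rewrite [LHS]frob_innerMl [LHS]frob_innerMl [RHS]frob_innerMr.
  by rewrite !trmx_mul !trmxK !mulmxA.
(* With [P = phi X] and [S = phi Y], this bounds twice the inner product of [X] and [Y] by that of
   [P] and [S] plus that of [A P A^T] and [B S B^T]. *)
have := frob_inner_half (p *m s^T) ((p *m A^T) *m (s *m B^T)^T).
rewrite !sqr_frob_norm_mul_trmx !trmx_mul !trmxK.
have -> : A *m p^T *m (p *m A^T) = A *m (p^T *m p) *m A^T by rewrite !mulmxA.
have -> : B *m s^T *m (s *m B^T) = B *m (s^T *m s) *m B^T by rewrite !mulmxA.
(* The conjugated term is in turn bounded through the norms of [P] and [S], which conjugation by
   isometries preserves. *)
have := frob_inner_half (A *m (p^T *m p) *m A^T) (B *m (s^T *m s) *m B^T).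
have conj m k (C : 'M[R]_(m, k)) D : C^T *m C = 1%:M ->
    frob_norm (C *m D *m C^T) = frob_norm D.
  by move=> CC; rewrite -mulmxA frob_norm_isometry// -frob_norm_trmx trmx_mul trmxK
    frob_norm_isometry// frob_norm_trmx.
by rewrite !conj//; lra.
Qed.

Lemma phi_bilipschitz r n (X Y : 'M[R]_(r, n)) :
  mdist (orbit_of X) (orbit_of Y) <= frob_norm (phi X - phi Y) /\
  frob_norm (phi X - phi Y) <= Num.sqrt 2 * mdist (orbit_of X) (orbit_of Y).
Proof.
rewrite mdist_orbitE; split; first exact: orbit_dist_le_phi.
have [Q QO ->] := orbit_dist_min X Y.
rewrite -ler_sqr ?nnegrE ?mulr_ge0 ?sqrtr_ge0 ?frob_norm_ge0// exprMn.
rewrite (sqr_sqrtr (ler0n R 2)).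
rewrite -(phi_orthogonal X QO); exact: frob_norm_phiB_le.
Qed.

End Optimal.

(* [frob_mx] is only a metric space; this alias carries the Hilbert structure. *)
Definition frob_space (R : realType) (m n : nat) : Type := 'M[R]_(m, n).

HB.instance Definition _ (R : realType) (m n : nat) :=
  GRing.Lmodule.copy (frob_space R m n) 'M[R]_(m, n).

(** * The Frobenius norm makes matrices a Hilbert space *)

Section FrobSpace.
Context {R : realType} {m n : nat}.

Lemma frob_normZ (a : R) (X : 'M[R]_(m, n)) :
  frob_norm (a *: X) = `|a| * frob_norm X.
Proof.
rewrite /frob_norm -sqrtr_sqr -sqrtrM ?sqr_ge0//; congr Num.sqrt.
by have := frob_inner_combo a 0 X 0; rewrite scaler0 addr0 => ->; ring.
Qed.

Lemma mx_norm_le_frob_norm (X : 'M[R]_(m, n)) : `|X| <= frob_norm X.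
Proof.
rewrite /Num.norm /= mx_normrE.
apply: bigmax_le => [|[i j] _]; first exact: frob_norm_ge0.
rewrite -ler_sqr ?nnegrE ?frob_norm_ge0// real_normK ?num_real//.
rewrite sqr_frob_norm frob_innerE (bigD1 j)//= (bigD1 i)//= -expr2 -addrA.
rewrite lerDl addr_ge0 ?sumr_ge0// => k _.
  by rewrite -expr2 sqr_ge0.
by apply: sumr_ge0 => l _; rewrite -expr2 sqr_ge0.
Qed.

Lemma frob_norm_le_mx_norm (X : 'M[R]_(m, n)) :
  frob_norm X <= (n * m)%:R * `|X|.
Proof.
rewrite -ler_sqr ?nnegrE ?mulr_ge0 ?frob_norm_ge0// sqr_frob_norm frob_innerE.
have le (i : 'I_m) (j : 'I_n) : X i j * X i j <= `|X| ^+ 2.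
  rewrite -expr2 -real_normK ?num_real// ler_sqr ?nnegrE//.
  rewrite [leRHS]/Num.norm /= mx_normrE.
  exact: (le_bigmax _ (fun ij => `|X ij.1 ij.2|) (i, j)).
apply: (@le_trans _ _ (\sum_(j < n) \sum_(i < m) `|X| ^+ 2)).
  by apply: ler_sum => j _; apply: ler_sum => i _.
rewrite !sumr_const !card_ord -mulrnA -[leLHS]mulr_natl exprMn (mulnC m).
rewrite ler_wpM2r ?sqr_ge0//.
by rewrite -natrX ler_nat; case: (n * m)%N => // k; rewrite leq_pmulr.
Qed.

End FrobSpace.

HB.instance Definition _ (R : realType) (m n : nat) :=
  @Lmodule_isNormed.Build R (frob_space R m n) (@frob_norm R m n)
    (@ler_frob_normD R m n) (@frob_normZ R m n) (@frob_norm_eq0 R m n).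

Section FrobHilbert.
Context {R : realType} {m n : nat}.

(** Completeness transfers from the sup norm, which is equivalent to the Frobenius norm. *)
Lemma frob_space_complete (F : set_system (frob_space R m n)) :
  ProperFilter F -> cauchy F -> cvg F.
Proof.
move=> FF /cauchyP cF.
have : cauchy (F : set_system 'M[R]_(m, n)).
  apply/cauchyP => e e0; have [X FX] := cF _ e0.
  exists X; apply: filterS FX => Y /=; rewrite -!ball_normE /=.
  exact/le_lt_trans/mx_norm_le_frob_norm.
move=> /cauchy_cvg /cvg_ex [L FL]; apply/cvg_ex; exists L.
apply/cvgrPdist_lt => e e0.
(* The successor keeps the divisor positive when a dimension is 0. *)
have d0 : 0 < e / (n * m).+1%:R :> R by rewrite divr_gt0.
move/cvgrPdist_lt: FL => /(_ _ d0); apply: filterS => X /=.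
rewrite ltr_pdivlMr// mulrC => le_e; apply/le_lt_trans: le_e.
apply: (le_trans (frob_norm_le_mx_norm _)).
by rewrite ler_wpM2r// ler_nat.
Qed.

HB.instance Definition _ :=
  Uniform_isComplete.Build (frob_space R m n) frob_space_complete.

Definition frob_dot (X Y : frob_space R m n) : R := frob_inner X Y.

Lemma frob_dot_bilinear : bilinear_for
  (GRing.Scale.Law.clone _ _ *%R _) (GRing.Scale.Law.clone _ _ (idfun \; *%R) _)
  frob_dot.
Proof.
split=> [Y|X] a U V; first exact: frob_inner_linear.
by rewrite /frob_dot !(@frob_inner_sym _ _ _ X) frob_inner_linear.
Qed.

HB.instance Definition _ := bilinear_isBilinear.Build R
  (frob_space R m n) (frob_space R m n) R _ _ frob_dot frob_dot_bilinear.

Lemma frob_dot_sym X Y : frob_dot X Y = (-1) ^+ false * idfun (frob_dot Y X).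
Proof. by rewrite mul1r; exact: frob_inner_sym. Qed.

HB.instance Definition _ := isHermitianSesquilinear.Build R
  (frob_space R m n) false (@idfun R) frob_dot frob_dot_sym.

Lemma frob_dot_gt0 X : X != 0 -> 0 < frob_dot X X.
Proof.
move=> X0; rewrite lt_neqAle frob_inner_ge0 andbT eq_sym.
by apply: contra X0 => /eqP /frob_inner_eq0 ->.
Qed.

HB.instance Definition _ :=
  isDotProduct.Build R (frob_space R m n) frob_dot frob_dot_gt0.

Lemma frob_space_hilbert : is_hilbert (frob_space R m n : completeNormedModType R).
Proof.
exists (frob_dot : {dot (frob_space R m n) for @idfun R}) => X.
exact/esym/sqr_frob_norm.
Qed.

End FrobHilbert.

(** * A discrete Wirtinger inequality for closed polygons *)

Section DiscreteWirtinger.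
Context {R : realType} {H : lmodType R}.
Variable ip : {dot H for @idfun R}.
Implicit Types x y z : H.

Lemma dotC x y : ip x y = ip y x.
Proof. by rewrite hermitian_subproof mul1r. Qed.

Lemma dotDl x y z : ip (x + y) z = ip x z + ip y z.
Proof. exact: linearDl. Qed.

Lemma dotZl a x y : ip (a *: x) y = a * ip x y.
Proof. exact: linearZl_LR. Qed.

Lemma dotNl x y : ip (- x) y = - ip x y.
Proof. by rewrite -scaleN1r dotZl mulN1r. Qed.

Lemma dot_ge0 x : 0 <= ip x x.
Proof.
have [->|x0] := eqVneq x 0; first by have := dotZl 0 0 0; rewrite scale0r mul0r => ->.
exact/ltW/neq0_dnorm_gt0.
Qed.

Lemma dotDD x y : ip (x + y) (x + y) = ip x x + ip y y + 2 * ip x y.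
Proof. by rewrite dotDl !(dotC _ (x + y)) !dotDl (dotC y x); ring. Qed.

Lemma dotBB x y : ip (x - y) (x - y) = ip x x + ip y y - 2 * ip x y.
Proof. by rewrite dotDD !(dotC _ (- y)) !dotNl (dotC _ (- y)) dotNl (dotC y x); ring. Qed.

Lemma sum_shift N k (g : nat -> R) : (forall j, g (j + N)%N = g j) ->
  \sum_(j < N) g (j + k)%N = \sum_(j < N) g j.
Proof.
move=> gN; elim: k => [|k IH]; first by apply: eq_bigr => j _; rewrite addn0.
rewrite -IH; apply: (addrI (g k)).
have := @big_ord_recl R 0 +%R N (fun j => g (j + k)%N).
rewrite big_ord_recr /= add0n addnC gN addrC => ->; congr (_ + _).
by apply: eq_bigr => j _; rewrite addSnnS.
Qed.

(* [C k] is the autocorrelation of [w] at lag [k]; halving the lag corresponds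
   to the half-angle formula. *)
Lemma antiperiodic_autocorrelation l (w : nat -> H) :
  (forall j, w (j + 2 ^ l.+1)%N = - w j) ->
  \sum_(j < 2 ^ l.+2) ip (w j) (w j.+1) <=
  cos (pi / 2 ^+ l.+1) * \sum_(j < 2 ^ l.+2) ip (w j) (w j).
Proof.
move=> anti; pose G k j := ip (w j) (w (j + k)%N).
pose C k := \sum_(j < 2 ^ l.+2) G k j.
have per j : w (j + 2 ^ l.+2)%N = w j.
  by rewrite [(2 ^ l.+2)%N]expnS mul2n -addnn addnA !anti opprK.
have shiftG k m : \sum_(j < 2 ^ l.+2) G k (j + m)%N = C k.
  by apply: sum_shift => j; rewrite /G addnAC !per.
have C0 : \sum_(j < 2 ^ l.+2) ip (w j) (w j) = C 0.
  by apply: eq_bigr => j _; rewrite /G addn0.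
suff /(_ l 0%N (addn0 l)) : forall i m, (i + m)%N = l ->
    C (2 ^ m)%N <= cos (pi / 2 ^+ i.+1) * C 0%N.
  by rewrite C0 expn0; congr (_ <= _); apply: eq_bigr => j _; rewrite /G addn1.
elim=> [m|i IH m iml].
  rewrite add0n => ml; rewrite expr1 cos_pihalf mul0r.
  (* At this lag, half the antiperiod, a shift by the lag negates every term. *)
  suff : C (2 ^ m)%N = - C (2 ^ m)%N by lra.
  rewrite -{1}(shiftG _ (2 ^ m)%N) -sumrN; apply: eq_bigr => j _.
  by rewrite /G -addnA addnn -mul2n -expnS ml anti dotC dotNl dotC.
have := IH m.+1; rewrite addnS -addSn iml => /(_ erefl).
rewrite expnS; set k := (2 ^ m)%N.
set a := pi / 2 ^+ i.+2; set c := cos a.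
have -> : pi / 2 ^+ i.+1 = a *+ 2 by rewrite /a [2 ^+ i.+2]exprS mulr2n; field.
rewrite cos_mulr2n -/c.
have c0 : 0 < c.
  rewrite /c cos_gt0_pihalf//; apply/andP; split.
    by rewrite (@lt_trans _ _ 0)// ?oppr_lt0 divr_gt0 ?pi_gt0// exprn_gt0.
  rewrite ltr_pM2l ?pi_gt0// ltf_pV2 ?posrE ?exprn_gt0//.
  by rewrite -[ltLHS]expr1 ltr_eXn2l ?ltr1n.
(* The summands are the squared norms of [w j + w (j + 2k) - 2c w (j + k)]. Summed, they give
   [8 c C k <= 2 C (2k) + (2 + 4 c^2) C 0], and the bound on [C (2k)] turns the right side into
   [8 c^2 C 0]. *)
have : 0 <= \sum_(j < 2 ^ l.+2) (G 0%N j + G 0%N (j + 2 * k)%N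
    + 2 * G (2 * k)%N j + 4 * c ^+ 2 * G 0%N (j + k)%N
    - 4 * c * G k j - 4 * c * G k (j + k)%N).
  apply: sumr_ge0 => j _.
  have := dot_ge0 (w j + w (j + 2 * k)%N - (2 * c) *: w (j + k)%N).
  rewrite dotBB dotDD dotDl !(dotC _ (_ *: _)) !dotZl (dotC _ (_ *: _)) dotZl.
  rewrite (dotC (w (j + k)%N) (w j)).
  rewrite /G !addn0 -addnA addnn -mul2n.
  by move=> /le_trans; apply; rewrite le_eqVlt; apply/orP; left; apply/eqP; ring.
rewrite !sumrB !big_split /= -!mulr_sumr !shiftG -/(C 0%N) -/(C k) -/(C (2 * k)%N).
move=> pos C2k; rewrite -(ler_pM2l (mulr_gt0 (ltr0n R 8) c0)); move: C2k pos.
by rewrite mulr2n; nra.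
Qed.
(** The diagonals [w] are antiperiodic, which bounds their autocorrelation at lag 1. Their
    increments are differences of opposite sides, and [|u - v|^2 <= 2 |u|^2 + 2 |v|^2]. *)
Lemma discrete_wirtinger l (z : nat -> H) :
  (forall j, z (j + 2 ^ l.+2)%N = z j) ->
  (1 - cos (pi / 2 ^+ l.+1)) *
    \sum_(j < 2 ^ l.+2) ip (z (j + 2 ^ l.+1)%N - z j) (z (j + 2 ^ l.+1)%N - z j) <=
  2 * \sum_(j < 2 ^ l.+2) ip (z j.+1 - z j) (z j.+1 - z j).
Proof.
move=> per; pose w j := z (j + 2 ^ l.+1)%N - z j.
pose D j := ip (z j.+1 - z j) (z j.+1 - z j).
have anti j : w (j + 2 ^ l.+1)%N = - w j.
  by rewrite /w -addnA addnn -mul2n -expnS per opprB.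
have perw j : w (j + 2 ^ l.+2)%N = w j by rewrite /w addnAC !per.
have W1 : \sum_(j < 2 ^ l.+2) ip (w j.+1) (w j.+1) = \sum_(j < 2 ^ l.+2) ip (w j) (w j).
  rewrite -(@sum_shift _ 1 (fun j => ip (w j) (w j))) => [|j]; last by rewrite perw.
  by apply: eq_bigr => j _; rewrite addn1.
have DE : \sum_(j < 2 ^ l.+2) D (j + 2 ^ l.+1)%N = \sum_(j < 2 ^ l.+2) D j.
  by apply: sum_shift => j; rewrite /D -addSn !per.
have : \sum_(j < 2 ^ l.+2) (ip (w j.+1) (w j.+1) + ip (w j) (w j) - 2 * ip (w j) (w j.+1))
    <= \sum_(j < 2 ^ l.+2) (2 * D (j + 2 ^ l.+1)%N + 2 * D j).
  apply: ler_sum => j _; rewrite /D.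
  have := dotBB (w j.+1) (w j); rewrite (dotC (w j.+1) (w j)) => <-.
  have -> : w j.+1 - w j =
      (z (j + 2 ^ l.+1).+1%N - z (j + 2 ^ l.+1)%N) - (z j.+1 - z j).
    by rewrite /w addSn !opprD !opprK addrACA.
  move: (_ - z (j + _)%N) (z j.+1 - z j) => u v.
  by have := dot_ge0 (u + v); rewrite (dotDD u v) (dotBB u v); lra.
rewrite sumrB !big_split /= -!mulr_sumr W1 DE.
by have := antiperiodic_autocorrelation anti; rewrite /D /w; lra.
Qed.
End DiscreteWirtinger.

(** * A closed curve in the orbit space and its images in Hilbert spaces *)

Section OrbitCircle.
Context {R : realType}.

(** Halving the angle at least halves [1 - cos], because [1 - cos (2a) = 2 (1 - cos a) (1 + cos a)]
    with [cos a] nonnegative. *)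
Lemma cos_pi_expn2 l : 1 - cos (pi / 2 ^+ l.+1) <= (2 ^+ l)^-1 :> R.
Proof.
elim: l => [|l IH]; first by rewrite expr1 cos_pihalf subr0 expr0 invr1.
move: IH; set a := pi / 2 ^+ l.+2.
have -> : pi / 2 ^+ l.+1 = a *+ 2 by rewrite /a [2 ^+ l.+2]exprS mulr2n; field.
have a0 : 0 <= cos a.
  rewrite cos_ge0_pihalf//; apply/andP; split.
    by rewrite (@le_trans _ _ 0)// ?oppr_le0 divr_ge0 ?pi_ge0// exprn_ge0.
  rewrite ler_pM2l ?pi_gt0// lef_pV2 ?posrE ?exprn_gt0//.
  by rewrite -[leLHS]expr1 ler_eXn2l ?ltr1n.
rewrite cos_mulr2n mulr2n [2 ^+ l.+1]exprS invfM.
by move: (2 ^+ l)^-1 (cos_le1 a) => x; nra.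
Qed.

(** A positive gap [2 a^2 - b^2] would be at most [a^2 / 2^(l+1)] for every [l], against the
    Archimedean property. *)
Lemma sqrt2_le_of_cos (a b : R) : 0 <= b ->
  (forall l, a ^+ 2 * (1 + cos (pi / 2 ^+ l.+2)) <= b ^+ 2) -> Num.sqrt 2 * a <= b.
Proof.
move=> b0 ab.
suff ab2 : 2 * a ^+ 2 <= b ^+ 2.
  rewrite (le_trans (ler_norm _))// -ler_sqr ?nnegrE//.
  by rewrite real_normK ?num_real// exprMn sqr_sqrtr.
rewrite leNgt; apply/negP => ba.
have d0 : 0 < 2 * a ^+ 2 - b ^+ 2 by rewrite subr_gt0.
have a2 : 0 <= a ^+ 2 by rewrite sqr_ge0.
have [l] : exists l : nat, a ^+ 2 / (2 * a ^+ 2 - b ^+ 2) < l%:R.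
  exists (Num.bound (a ^+ 2 / (2 * a ^+ 2 - b ^+ 2))).
  by rewrite archi_boundP// divr_ge0// ltW.
rewrite ltr_pdivrMr// => al.
have l2 : l%:R <= 2 ^+ l.+1 :> R.
  by rewrite -natrX ler_nat (leq_trans (ltnW (ltn_expl l (ltnSn 1))))// leq_exp2l.
have := ab l; have := cos_pi_expn2 l.+1; rewrite -[leRHS]mul1r ler_pdivlMr ?exprn_gt0//.
move: (cos _) (2 ^+ l.+1) l2 => c p lp cp abc.
have := ler_wpM2l a2 cp; have := ler_wpM2r (ltW d0) lp.
have p0 : 0 <= p by apply: le_trans lp.
have : (2 * a ^+ 2 - b ^+ 2) * p <= a ^+ 2 * (1 - c) * p by rewrite ler_wpM2r//; lra.
by lra.
Qed.

Context {r n : nat}.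

Definition circle_row (t : R) : 'rV[R]_n.+2 :=
  \row_j (if j == 0%N :> nat then cos t else if j == 1%N :> nat then sin t else 0).

(** With a single nonzero row, [Q] only rescales inner products by its corner entry, so points a
    quarter turn apart stay orthogonal under every [Q]. Adding [pi] to [t] negates the point and
    keeps its orbit. *)
Definition circle_point (t : R) : 'M[R]_(r.+1, n.+2) :=
  delta_mx ord0 ord0 *m circle_row t.

Lemma circle_row_mul s t : circle_row s *m (circle_row t)^T = (cos (s - t))%:M.
Proof.
rewrite [LHS]mx11_scalar mxE 2!big_ord_recl big1 => [|i _]; last first.
  by rewrite !mxE /= mul0r.
by rewrite !mxE /= addr0 cosB.
Qed.

Lemma frob_inner_circle_point (Q : 'M[R]_r.+1) s t :
  frob_inner (Q *m circle_point s) (circle_point t) =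
  cos (s - t) * \tr (Q *m delta_mx ord0 ord0).
Proof.
rewrite frob_inner_tr /circle_point trmx_mul trmx_delta !mulmxA.
rewrite -(mulmxA _ (circle_row s)).
by rewrite circle_row_mul mul_mx_scalar -scalemxAl mxtraceZ -mulmxA mul_delta_mx.
Qed.

Lemma frob_inner_circle_point1 s t :
  frob_inner (circle_point s) (circle_point t) = cos (s - t).
Proof.
rewrite -[circle_point s]mul1mx frob_inner_circle_point mul1mx.
rewrite /mxtrace big_ord_recl big1 => [|i _]; by rewrite mxE/= ?addr0 ?mulr1.
Qed.

Lemma orbit_dist_circle_point_le s t :
  orbit_dist (circle_point s) (circle_point t) ^+ 2 <= 2 - 2 * cos (s - t).
Proof.
have := orbit_dist_le (circle_point s) (circle_point t) orthogonal1.
rewrite mul1mx -ler_sqr ?nnegrE ?orbit_dist_ge0 ?frob_norm_ge0// sqr_frob_normB.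
by rewrite !sqr_frob_norm !frob_inner_circle_point1 !subrr cos0; lra.
Qed.

Lemma orbit_dist_circle_point_pihalf t :
  orbit_dist (circle_point (t + pi / 2)) (circle_point t) ^+ 2 = 2.
Proof.
have [Q QO ->] := orbit_dist_min (circle_point (t + pi / 2)) (circle_point t).
rewrite sqr_frob_normB frob_norm_orthogonal// !sqr_frob_norm !frob_inner_circle_point1.
by rewrite frob_inner_circle_point (addrC t) addrK !subrr cos0 cos_pihalf; ring.
Qed.

Lemma orbit_of_circle_point_pi t :
  orbit_of (circle_point (t + pi)) = orbit_of (circle_point t).
Proof.
apply/eqP/orbit_ofP; exists (- 1%:M).
  by rewrite /orthogonal /= mulmxN mulmx1 linearN /= trmx1 opprK.
rewrite mulNmx mul1mx -mulmxN; congr (_ *m _); apply/rowP => j; rewrite !mxE.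
by case: ifP => _; [rewrite cosDpi opprK|case: ifP => _; rewrite ?oppr0// sinDpi opprK].
Qed.

(** For the image polygon with angular step [t], squared sides are at most [b^2 (2 - 2 cos t)] and
    squared diagonals at least [2 a^2]. The Wirtinger inequality at angle [2t] then gives
    [a^2 (1 + cos t) <= b^2]. *)
Lemma hilbert_bilipschitz_sqrt2 (H : completeNormedModType R)
    (f : orbit_space R r.+1 n.+2 -> H) (a b : R) :
  is_hilbert H -> 0 <= a -> 0 <= b ->
  (forall x y, a * mdist x y <= `|f x - f y|) ->
  (forall x y, `|f x - f y| <= b * mdist x y) ->
  Num.sqrt 2 * a <= b.
Proof.
move=> [ip ipE] a0 b0 fa fb; apply: sqrt2_le_of_cos => // l.
set t : R := pi / 2 ^+ l.+2.
pose z j := f (orbit_of (circle_point (j%:R * t))).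
have tN : (2 ^ l.+2)%:R * t = pi by rewrite natrX mulrC divfK// expf_neq0.
have th : (2 ^ l.+1)%:R * t = pi / 2.
  by rewrite -tN natrX natrX [2 ^+ l.+2]exprS; field.
have zN j : z (j + 2 ^ l.+2)%N = z j.
  by rewrite /z natrD mulrDl tN orbit_of_circle_point_pi.
have := discrete_wirtinger ip zN.
set c := cos t; set N := (2 ^ l.+2)%N.
have N0 : 0 < N%:R :> R by rewrite ltr0n expn_gt0.
have -> : pi / 2 ^+ l.+1 = t *+ 2 by rewrite /t [2 ^+ l.+2]exprS mulr2n; field.
rewrite cos_mulr2n -/c.
have c1 : c < 1.
  rewrite lt_neqAle cos_le1 andbT; apply/negP => /eqP c1.
  have : 0 < sin t.
    rewrite sin_gt0_pi//; apply/andP; split.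
      by rewrite divr_gt0 ?pi_gt0// exprn_gt0.
    by rewrite gtr_pMr ?pi_gt0// invf_lt1 ?exprn_gt0// exprn_egt1 ?ltr1n.
  by have := cos2Dsin2 t; rewrite -/c c1 => s2 s0; nra.
have up : \sum_(j < N) ip (z j.+1 - z j) (z j.+1 - z j) <= N%:R * (b ^+ 2 * (2 - 2 * c)).
  rewrite -[N in leRHS]card_ord mulr_natl -sumr_const; apply: ler_sum => j _.
  have dj := orbit_dist_circle_point_le (j.+1%:R * t) (j%:R * t).
  rewrite ipE; move: dj; set d := orbit_dist _ _ => dj.
  apply: (@le_trans _ _ ((b * d) ^+ 2)).
    by rewrite ler_sqr ?nnegrE ?mulr_ge0 ?orbit_dist_ge0// /d -mdist_orbitE fb.
  rewrite exprMn ler_wpM2l ?sqr_ge0// (le_trans dj)//.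
  by rewrite -mulrBl -[j.+1%:R]natr1 (addrC _ 1) addrK mul1r.
have lo : N%:R * (a ^+ 2 * 2) <=
    \sum_(j < N) ip (z (j + 2 ^ l.+1)%N - z j) (z (j + 2 ^ l.+1)%N - z j).
  rewrite -[N in leLHS]card_ord mulr_natl -sumr_const; apply: ler_sum => j _.
  rewrite ipE -(orbit_dist_circle_point_pihalf (j%:R * t)) -exprMn.
  rewrite ler_sqr ?nnegrE ?mulr_ge0 ?orbit_dist_ge0// -mdist_orbitE.
  by rewrite /z natrD (mulrDl j%:R) th fa.
move=> wirt.
have c2 : 0 <= 1 - (c ^+ 2 *+ 2 - 1).
  have := cos2Dsin2 t; have := sqr_ge0 (sin t); rewrite -/c mulr2n; lra.
have := le_trans (ler_wpM2l c2 lo) (le_trans wirt (ler_wpM2l (ler0n R 2) up)).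
(* The common factor of both sides, since [1 - cos (2t) = 2 (1 - c) (1 + c)]. *)
have k0 : 0 < 4 * N%:R * (1 - c) by rewrite !mulr_gt0// subr_gt0.
move=> h; rewrite -(ler_pM2l k0); move: h.
by apply: etrans; congr (_ <= _); ring.
Qed.

End OrbitCircle.

(** * Optimal Lipschitz constants and distortion *)

Lemma phi_quot_bilipschitz (R : realType) r n (x y : orbit_space R r n) :
  mdist x y <= mdist (phi_quot x) (phi_quot y) /\
  mdist (phi_quot x) (phi_quot y) <= Num.sqrt 2 * mdist x y.
Proof.
rewrite -[x]reprK -[y]reprK -!/(orbit_of _) !phi_quotE; exact: phi_bilipschitz.
Qed.

Lemma frob_norm_delta_mx (R : realType) m n (i : 'I_m) (j : 'I_n) :
  frob_norm (delta_mx i j : 'M[R]_(m, n)) = 1.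
Proof.
rewrite /frob_norm /frob_inner trmx_delta mul_delta_mx /mxtrace (bigD1 j)//= big1.
  by rewrite mxE !eqxx addr0 sqrtr1.
by move=> k kj; rewrite mxE (negbTE kj).
Qed.

Lemma mdist_orbit_of0 (R : realType) r n (X : 'M[R]_(r, n)) :
  mdist (orbit_of X) (orbit_of (0 : 'M[R]_(r, n))) = frob_norm X.
Proof.
rewrite mdist_orbitE; have [Q QO ->] := orbit_dist_min X 0.
by rewrite subr0 frob_norm_orthogonal.
Qed.

Lemma mdist_phi_quot0 (R : realType) r n (X : 'M[R]_(r, n)) :
  mdist (phi_quot (orbit_of X)) (phi_quot (orbit_of (0 : 'M[R]_(r, n)))) = frob_norm X.
Proof.
rewrite !phi_quotE.
have -> : phi (0 : 'M[R]_(r, n)) = 0.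
  by apply: frob_norm_eq0; rewrite frob_norm_phi frob_norm0.
by rewrite -[RHS]frob_norm_phi -[phi X in RHS]subr0.
Qed.

(** Distances to the zero orbit are preserved exactly, so any nonzero matrix shows that 1 cannot be
    improved. *)
Lemma lower_lip_phi_quot (R : realType) r n :
  lower_lip (@phi_quot R r.+1 n.+1) = 1%:E.
Proof.
apply/eqP; rewrite eq_le; apply/andP; split.
  apply: ge_ereal_sup => a [a0].
  move=> /(_ (orbit_of (delta_mx ord0 ord0)) (orbit_of 0)).
  by rewrite mdist_orbit_of0 mdist_phi_quot0 frob_norm_delta_mx mule1.
apply: ereal_sup_ubound; split => [|x y]; first by rewrite lee_fin.
by rewrite mul1e lee_fin (phi_quot_bilipschitz x y).1.
Qed.

Lemma upper_lip_phi_quot (R : realType) r n :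
  upper_lip (@phi_quot R r.+1 n.+2) = (Num.sqrt 2)%:E.
Proof.
apply/eqP; rewrite eq_le; apply/andP; split.
  apply: ereal_inf_lbound; split => [|x y]; first by rewrite lee_fin sqrtr_ge0.
  by rewrite -EFinM lee_fin (phi_quot_bilipschitz x y).2.
apply: le_ereal_inf_tmp => -[b| |] [b0 ub]; last by [].
  rewrite lee_fin -[Num.sqrt 2]mulr1.
  (* The general obstruction applies to [phi_quot] itself, with lower constant 1. *)
  apply: (@hilbert_bilipschitz_sqrt2 R r n (frob_space R n.+2 n.+2) phi_quot).
  - exact: frob_space_hilbert.
  - exact: ler01.
  - by rewrite -lee_fin.
  - by move=> x y; rewrite mul1r; exact: (phi_quot_bilipschitz x y).1.
  - by move=> x y; have := ub x y; rewrite -EFinM lee_fin.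
exact: leey.
Qed.

Lemma distortion_phi_quot (R : realType) r n :
  distortion (@phi_quot R r.+1 n.+2) = (Num.sqrt 2)%:E.
Proof.
by rewrite /distortion lower_lip_phi_quot upper_lip_phi_quot eqe oner_eq0 /= inve1 mule1.
Qed.

Lemma distortion_hilbert_ge (R : realType) r n (H : completeNormedModType R)
    (f : orbit_space R r.+1 n.+2 -> norm_metric H) :
  is_hilbert H -> ((Num.sqrt 2)%:E <= distortion f)%E.
Proof.
move=> hilb; rewrite /distortion.
case: ifPn => [_|]; first exact: leey.
rewrite negb_or => /andP[].
have [] := lower_lip_max f; have [] := upper_lip_min f.
case: (upper_lip f) => [b| |]//; case: (lower_lip f) => [a| |]//; last first.
  (* Two orbits at distance 1 exclude an infinite lower constant. *)
  move=> _ _ _ /(_ (orbit_of (delta_mx ord0 ord0)) (orbit_of 0)).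
  by rewrite mdist_orbit_of0 frob_norm_delta_mx mule1 leye_eq.
rewrite !lee_fin eqe => b0 fb a0 fa a_neq0 _.
have a_gt0 : 0 < a by rewrite lt_neqAle eq_sym a_neq0.
rewrite inver (negbTE a_neq0) -EFinM lee_fin ler_pdivlMr//.
by apply: (@hilbert_bilipschitz_sqrt2 R r n H f).
Qed.

Lemma euclidean_distortion_orbit_space (R : realType) r n :
  euclidean_distortion (orbit_space R r.+1 n.+2) = (Num.sqrt 2)%:E.
Proof.
apply/eqP; rewrite eq_le; apply/andP; split.
  apply: ereal_inf_lbound; exists (frob_space R n.+2 n.+2).
  split; first exact: frob_space_hilbert.
  by exists phi_quot; rewrite -(distortion_phi_quot R r n).
by apply: le_ereal_inf_tmp => c [H [hilb [f <-]]]; exact: distortion_hilbert_ge.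
Qed.

Theorem proposition17 (R : realType) (r n : nat)
    (hr : (1 <= r)%N) (hn : (1 <= n)%N) :
  (forall X Y : 'M[R]_(r, n),
      mdist (orbit_of X) (orbit_of Y) <= frob_norm (phi X - phi Y) /\
      frob_norm (phi X - phi Y)
        <= Num.sqrt 2 * mdist (orbit_of X) (orbit_of Y)) /\
  lower_lip (@phi_quot R r n) = 1%:E /\
  ((2 <= n)%N -> upper_lip (@phi_quot R r n) = (Num.sqrt 2)%:E) /\
  ((2 <= n)%N ->
    euclidean_distortion (orbit_space R r n) = distortion (@phi_quot R r n) /\
    distortion (@phi_quot R r n) = (Num.sqrt 2)%:E).
Proof.
split; first exact: phi_bilipschitz.
case: r hr => // r _; case: n hn => // n _; split; first exact: lower_lip_phi_quot.
case: n => [|n]; split=> // _; first exact: upper_lip_phi_quot.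
by rewrite euclidean_distortion_orbit_space distortion_phi_quot.
Qed.
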